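(* Let $L$ be a strongly continuous domain. Then $(L,\lambda_s(L))$ is a $T_2$ space.
   Context: A dcpo is a poset in which every directed subset (directed sets are nonempty) has a supremum. For $x\in L$ and $A\subseteq L$: $\uparrow x=\{y\in L: x\le y\}$, $\uparrow A=\bigcup_{a\in A}\uparrow a$; an upper set is a set $U$ with $U=\uparrow U$. Strong Scott topology: a subset $U\subseteq L$ is strongly Scott open if $U$ is an upper set and for every directed $D\subseteq L$ and every $x\in L$, $\bigcap_{d\in D}\uparrow d\cap\uparrow x\subseteq U$ implies $\uparrow d\cap\uparrow x\subseteq U$ for some $d\in D$. Let $\sigma^s(L)$ be the set of all strongly Scott open subsets. It is closed under binary intersections, and the strong Scott topology $\sigma_s(L)$ is the topology having $\sigma^s(L)$ as a base. A dcpo $L$ is a strongly continuous domain if for every $U\in\sigma_s(L)$ and $x\in U$ there is $u\in U$ with $x\in\mathrm{int}_{\sigma_s(L)}\uparrow u\subseteq\uparrow u\subseteq U$ (i.e. $(L,\sigma_s(L))$ is a C-space). The lower topology $\omega(L)$ is generated by the subbase $\{L\}\cup\{L\setminus\uparrow x:x\in L\}$. The strong Lawson topology $\lambda_s(L)=\sigma_s(L)\vee\omega(L)$ is the common refinement, i.e. the topology generated by $\sigma_s(L)\cup\omega(L)$. *)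

(* Defs.v *)
From HB Require Import structures.
From mathcomp Require Import all_boot all_order.
From mathcomp Require Import boolp classical_sets topology.

Set Implicit Arguments.
Unset Strict Implicit.
Unset Printing Implicit Defensive.

Import Order.TTheory.
Local Open Scope classical_set_scope.
Local Open Scope order_scope.

Section StrongScott.
Context {d : Order.disp_t} {L : porderType d}.
Implicit Types (x y z : L) (A D U V : set L).

Definition directed D : Prop :=
  D !=set0 /\
  forall x y, D x -> D y -> exists z, [/\ D z, x <= z & y <= z].

Definition up x : set L := [set y | x <= y].

Definition up_closure A : set L := \bigcup_(a in A) up a.

Definition upper_set U : Prop := U = up_closure U.

Definition strongly_scott_open U : Prop :=
  upper_set U /\
  forall D x, directed D ->
    (\bigcap_(e in D) up e) `&` up x `<=` U ->
    exists2 e, D e & up e `&` up x `<=` U.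

Lemma upper_setP U : upper_set U <-> (forall x y, U x -> x <= y -> U y).
Proof.
split=> [UE x y Ux xy | Uup]; first by rewrite UE; exists x.
apply/seteqP; split=> [x Ux | y [x Ux xy]]; last exact: Uup xy.
by exists x => //; exact: lexx.
Qed.

Lemma strongly_scott_openT : strongly_scott_open setT.
Proof.
split=> [|D x [[e De] _] _]; first exact/upper_setP.
by exists e.
Qed.

Lemma strongly_scott_openI U V :
  strongly_scott_open U -> strongly_scott_open V ->
  strongly_scott_open (U `&` V).
Proof.
move=> [/upper_setP upU oU] [/upper_setP upV oV]; split.
  by apply/upper_setP => x y [Ux Vx] xy; split; [exact: upU xy|exact: upV xy].
move=> D x dD; rewrite subsetI => -[sU sV].
have [e De eU] := oU D x dD sU; have [f Df fV] := oV D x dD sV.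
have [g [Dg eg fg]] := dD.2 e f De Df.
exists g => // y [gy xy]; split.
  by apply: eU; split=> //; exact: le_trans eg gy.
by apply: fV; split=> //; exact: le_trans fg gy.
Qed.

End StrongScott.

Definition dcpo {d : Order.disp_t} (L : porderType d) : Prop :=
  forall D : set L, directed D -> exists s : L, isLub D s.

(* The three topologies are put on three aliases of the carrier, so that the
   library notions open, interior and hausdorff_space refer to the intended
   topology. *)
Definition strong_scott {d : Order.disp_t} (L : porderType d) : Type := L.
Definition lower_space {d : Order.disp_t} (L : porderType d) : Type := L.
Definition strong_lawson {d : Order.disp_t} (L : porderType d) : Type := L.

Section Topologies.
Context {d : Order.disp_t} {L : porderType d}.

HB.instance Definition _ := Choice.on (strong_scott L).

Let strong_scott_cover :
  \bigcup_(U in @strongly_scott_open d L) id U = [set: strong_scott L].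
Proof.
by apply/seteqP; split=> // x _; exists setT => //; exact: strongly_scott_openT.
Qed.

Let strong_scott_join (U V : set L) (t : strong_scott L) :
  strongly_scott_open U -> strongly_scott_open V -> id U t -> id V t ->
  exists W : set L, [/\ strongly_scott_open W, id W t & id W `<=` id U `&` id V].
Proof.
by move=> oU oV Ut Vt; exists (U `&` V); split=> //; exact: strongly_scott_openI.
Qed.

HB.instance Definition _ := isBaseTopological.Build (strong_scott L)
  strong_scott_cover strong_scott_join.

HB.instance Definition _ := Choice.on (lower_space L).

HB.instance Definition _ := isSubBaseTopological.Build (lower_space L)
  ([set [set: L]] `|` range (fun x : L => ~` up x)) id.

HB.instance Definition _ := Choice.on (strong_lawson L).

HB.instance Definition _ := isSubBaseTopological.Build (strong_lawson L)
  ((@open (strong_scott L) : set (set L)) `|`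
   (@open (lower_space L) : set (set L))) id.

End Topologies.

Definition strongly_continuous_domain {d : Order.disp_t} (L : porderType d)
    : Prop :=
  dcpo L /\
  forall (U : set (strong_scott L)) (x : strong_scott L), open U -> U x ->
    exists u : L, [/\ U u, interior (up u : set (strong_scott L)) x
                     & up u `<=` U].

(* Main.v *)
Require Import Defs.
From mathcomp Require Import all_boot all_order.
From mathcomp Require Import boolp classical_sets topology.

(** Distinct points always fail one of the two inequalities, by antisymmetry;
    say that [x <= y] is false.  The complement of the principal ideal of [y]
    contains [x] and is strongly Scott open ([strongly_scott_open_not_le]).
    Strong continuity therefore interpolates a point [u], not below [y], with
    [x] in the strong Scott interior of [up u].  That interior and the
    complement of [up u], which is open in the lower topology and contains [y],
    are disjoint neighbourhoods of [x] and [y] ([not_le_separated]). *)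

Import Order.POrderTheory.
Local Open Scope classical_set_scope.
Local Open Scope order_scope.

Section StrongLawson.
Context {d : Order.disp_t} {L : porderType d}.
Implicit Types (x y : L) (U : set L).

Lemma strongly_scott_open_open U :
  strongly_scott_open U -> open (U : set (strong_scott L)).
Proof.
move=> oU; exists [set U]; last by rewrite bigcup_set1.
by move=> _ ->.
Qed.

Lemma open_lower_setC_up x : open (~` up x : set (lower_space L)).
Proof.
exists [set ~` up x]; last by rewrite bigcup_set1.
by move=> _ ->; apply: (@finI_from1 _ _ _ id); right; exists x.
Qed.

Lemma open_strong_lawson U :
  open (U : set (strong_scott L)) \/ open (U : set (lower_space L)) ->
  open (U : set (strong_lawson L)).
Proof.
move=> oU; exists [set U]; last by rewrite bigcup_set1.
by move=> _ ->; exact: (@finI_from1 _ _ _ id).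
Qed.

(** If [x] and every [e] in [D] were below [y], then [y] itself would lie in
    the intersection that is assumed to avoid the principal ideal of [y].  So
    [x] or some [e] in [D] is not below [y], and then neither is any common
    upper bound of that [e] and [x]. *)
Lemma strongly_scott_open_not_le y : strongly_scott_open [set x | ~ x <= y].
Proof.
split=> [|D x [[e0 De0] _] sub].
  by apply/upper_setP => x z /= nxy xz zy; apply: nxy; exact: le_trans zy.
have [xy|/negP nxy] := boolP (x <= y); last first.
  (* [x] alone is not below [y], so any element of [D] will do *)
  exists e0 => // z [_ xz] zy; apply: nxy.
  exact: le_trans zy.
have [e De ney] : exists2 e, D e & ~ e <= y.
  apply: contrapT => noe; apply: (sub y) => //; split=> // e De.
  by apply: contrapT => ney; apply: noe; exists e.
exists e => // z [ez _] zy; apply: ney.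
exact: le_trans zy.
Qed.

(** The separation is not symmetric: the neighbourhood of [x] comes from the
    strong Scott topology and that of [y] from the lower topology. *)
Lemma not_le_separated x y : strongly_continuous_domain L -> ~ x <= y ->
  exists U V : set (strong_lawson L),
    [/\ open_nbhs (x : strong_lawson L) U, open_nbhs (y : strong_lawson L) V
      & U `&` V = set0].
Proof.
move=> [_ interp] nxy.
have [u [nuy xu _]] :=
  interp _ x (strongly_scott_open_open _ (strongly_scott_open_not_le y)) nxy.
exists (interior (up u : set (strong_scott L))), (~` up u); split.
- by split=> //; apply: open_strong_lawson; left; exact: open_interior.
- by split=> //; apply: open_strong_lawson; right; exact: open_lower_setC_up.
- by apply/seteqP; split=> // z [/interior_subset uz].
Qed.

Lemma cluster_strong_lawson_le (x y : strong_lawson L) :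
  strongly_continuous_domain L -> cluster (nbhs x) y -> (x : L) <= y.
Proof.
move=> hL xy; apply/negPn/negP => /negP nxy.
have [U [V [xU yV UV0]]] := not_le_separated _ _ hL nxy.
have [z UVz] := xy _ _ (open_nbhs_nbhs xU) (open_nbhs_nbhs yV).
by have : set0 z by rewrite -UV0.
Qed.

End StrongLawson.

Theorem theorem4p14 (d : Order.disp_t) (L : porderType d)
  (hL : strongly_continuous_domain L) : hausdorff_space (strong_lawson L).
Proof.
move=> x y xy; apply: (@le_anti d L); apply/andP; split.
  exact: cluster_strong_lawson_le.
apply: cluster_strong_lawson_le => // A B yA xB.
by rewrite setIC; exact: xy.
Qed.
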